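(* Let $G$ be a forest and $s=0$. Assume that all pieces, both in partitions and in allocations, must be pairwise disjoint (empty-intersection setting). Then for any $n\ge1$ agents with arbitrary monotone (continuous, nonnegative) valuations, a maximin allocation exists.
   Context: Cake model: the cake is a finite undirected graph $G=(V,E)$, not necessarily connected, in which every edge is a segment of positive length; points of $G$ are its vertices and the points on its edges. A piece of cake is a finite union of intervals (open, half-open or closed) contained in edges, together possibly with some vertices. A piece $X$ is connected if any two points of $X$ can be joined by a path in $G$ that stays inside $X$. There are $n$ agents $[n]$. Each agent $i$ has a valuation $v_i$ on pieces of cake that is nonnegative, monotone ($X\subseteq Y\Rightarrow v_i(X)\le v_i(Y)$) and continuous; in particular, single points have value $0$. Empty-intersection setting with $s=0$: a $k$-partition is a set of $k$ pairwise disjoint connected pieces (they need not cover $G$). An allocation is a vector $(A_1,\dots,A_n)$ of pairwise disjoint connected pieces, where $A_i$ is given to agent $i$. Maximin share: $\mathrm{MMS}_i^{k}=\sup_{\{P_1,\dots,P_k\}}\min_{j\in[k]} v_i(P_j)$, where the supremum ranges over $k$-partitions. A maximin allocation is an allocation with $v_i(A_i)\ge\mathrm{MMS}_i^{n}$ for all $i\in[n]$. *)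

(* Defs.v *)
From HB Require Import structures.
From mathcomp Require Import all_boot all_order all_algebra.
From mathcomp Require Import all_classical all_reals.
From Stdlib Require Import Relation_Operators.
From mathcomp Require Import ereal topology normedtype sequences measure lebesgue_measure.
Set Implicit Arguments. Unset Strict Implicit. Unset Printing Implicit Defensive.
Import Order.TTheory GRing.Theory Num.Theory.
Local Open Scope classical_set_scope.
Local Open Scope ring_scope.

(** A cake: a finite undirected (multi)graph whose edges are segments of
    positive length.  Edge [e] goes from [gsrc e] to [gdst e] and is
    identified with the segment [0, glen e]; position 0 is the vertex
    [gsrc e], position [glen e] is the vertex [gdst e]. *)
Record graph (R : realType) := Graph {
  gV : finType;
  gE : finType;
  gsrc : gE -> gV;
  gdst : gE -> gV;
  glen : gE -> R;
  glen_pos : forall e, 0 < glen e }.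

(** Points of the cake: vertices, and interior points of edges
    ([PE e x] with 0 < x < glen e). *)
Inductive gpoint (V E R : Type) := PV of V | PE of E & R.

Section Cake.
Variable R : realType.
Variable G : graph R.

Definition cake_point := gpoint (gV G) (gE G) R.

Definition pos (e : gE G) (t : R) : cake_point :=
  if t == 0 then PV _ R (gsrc e)
  else if t == glen e then PV _ R (gdst e)
  else PE (gV G) e t.

Definition is_piece (X : set cake_point) : Prop :=
  exists (W : {set gV G}) (I : seq (gE G * interval R)),
    (forall p, p \in I -> forall t, t \in p.2 -> 0 <= t <= glen p.1) /\
    X = [set PV _ R w | w in [set w | w \in W]] `|`
        [set q | exists2 p, p \in I & exists2 t, t \in p.2 & q = pos p.1 t].

Definition path_step (X : set cake_point) (p q : cake_point) : Prop :=
  exists e a b, [/\ 0 <= a <= glen e, 0 <= b <= glen e,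
    p = pos e a, q = pos e b &
    forall t, Num.min a b <= t <= Num.max a b -> X (pos e t)].

Definition connected_piece (X : set cake_point) : Prop :=
  forall p q, X p -> X q -> Relation_Operators.clos_refl_trans _ (path_step X) p q.

Definition glength (S : set cake_point) : \bar R :=
  (\sum_(e : gE G) lebesgue_measure [set x : R | (0 < x < glen e)%R /\ S (PE _ e x)])%E.

Definition valuation (v : set cake_point -> R) : Prop :=
  [/\ (forall X, is_piece X -> 0 <= v X),
      (forall X Y, is_piece X -> is_piece Y -> X `<=` Y -> v X <= v Y),
      (forall X, is_piece X -> forall eps : R, 0 < eps ->
         exists2 delta : R, 0 < delta & forall Y, is_piece Y ->
           (glength ((X `\` Y) `|` (Y `\` X)) < delta%:E)%E ->
           `|v Y - v X| < eps) &
      (forall p : cake_point, v [set p] = 0)].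

(** k-partition (empty-intersection setting, s = 0): k pairwise disjoint
    connected pieces (not required to cover G). *)
Definition kpartition (k : nat) (P : 'I_k -> set cake_point) : Prop :=
  (forall j, is_piece (P j) /\ connected_piece (P j)) /\
  (forall j j', j != j' -> P j `&` P j' = set0).

Definition MMS (v : set cake_point -> R) (k : nat) : \bar R :=
  ereal_sup [set (\big[Order.min/+oo%E]_(j < k) (v (P j))%:E)%E
            | P in [set P : 'I_k -> set cake_point | kpartition P]].

Definition allocation (n : nat) (A : 'I_n -> set cake_point) : Prop := kpartition A.

(** Forest: G has no cycle.  A cycle is a nonempty sequence of pairwise
    distinct edges es and pairwise distinct vertices vs (same length k)
    such that the i-th edge joins vs_i and vs_{i+1 mod k}
    (k = 1: a loop; k = 2: two parallel edges). *)
Definition joins (e : gE G) (a b : gV G) : bool :=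
  ((gsrc e == a) && (gdst e == b)) || ((gsrc e == b) && (gdst e == a)).

Definition is_forest : Prop :=
  ~ exists (es : seq (gE G)) (vs : seq (gV G)),
      [/\ 0 < size es, size vs = size es, uniq es, uniq vs &
        forall i e a b, onth es i = Some e -> onth vs i = Some a ->
          onth vs (i.+1 %% size es) = Some b -> joins e a b]%N.

End Cake.

(* Main.v *)
(** Root every tree of the forest and move a knife from the leaves towards the
    roots, stopping as soon as the part below it is worth [t i] to some remaining
    agent [i]; that agent takes this part and leaves.  Two disjoint connected pieces
    meeting the part and worth [t j] to another agent [j] cannot exist: neither is
    contained in what lies below an earlier position of the knife, so both would
    contain a common knife position.  Hence each other agent loses at most one piece of
    a partition into [n] pieces worth [t j], and everybody gets served.

    This is run with [t i = MMS_i - 1/(m+1)], as the supremum in [MMS_i] need not be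
    known to be attained.  The resulting allocation is determined by finite data
    and [n] bounded real knife positions; along an ultrafilter the former is
    constant and the latter converge as [m] tends to infinity, and the allocation given
    by the limit positions is maximin by continuity of the valuations. *)

Require Import Defs.
From HB Require Import structures.
From mathcomp Require Import all_boot all_order all_algebra.
From mathcomp Require Import all_classical all_reals.
From mathcomp Require Import ereal topology normedtype sequences measure lebesgue_measure.
From mathcomp Require Import lra.
From Stdlib Require Import Relation_Operators.
Import Order.TTheory GRing.Theory Num.Theory.
Import numFieldNormedType.Exports.
Set Implicit Arguments. Unset Strict Implicit. Unset Printing Implicit Defensive.
Local Open Scope classical_set_scope.
Local Open Scope ring_scope.

(** * Rooting a forest *)

Section Rooting.
Variables (R : realType) (G : graph R).
Implicit Types (e : gE G) (a b : gV G) (E : {set gE G}).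

Definition child (up : gE G -> bool) e := if up e then gsrc e else gdst e.
Definition parent (up : gE G -> bool) e := if up e then gdst e else gsrc e.

Definition incident e a := (gsrc e == a) || (gdst e == a).

Lemma incident_joins e a : incident e a -> exists b, joins e b a.
Proof.
case/orP=> /eqP <-.
- by exists (gdst e); rewrite /joins !eqxx orbT.
- by exists (gsrc e); rewrite /joins !eqxx.
Qed.

Lemma joins_incident e a b : joins e a b -> incident e a && incident e b.
Proof. by rewrite /joins /incident => /orP[] /andP[-> ->] //=; rewrite orbT. Qed.

(** The edges and the vertices of a simple path, most recent first. *)
Fixpoint trail E (es : seq (gE G)) (vs : seq (gV G)) : bool :=
  match es, vs with
  | [::], [:: _] => true
  | e :: es', a :: vs' =>
    [&& e \in E, trail E es' vs', a \notin vs' & joins e a (head a vs')]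
  | _, _ => false
  end.

Lemma trail_size E es vs : trail E es vs -> size vs = (size es).+1.
Proof.
elim: es vs => [|e es IH] [|a vs] //=; first by case: vs.
by case/and4P=> _ /IH -> .
Qed.

Lemma trail_uniq E es vs : trail E es vs -> uniq vs.
Proof.
elim: es vs => [|e es IH] [|a vs] //=; first by case: vs.
by case/and4P=> _ /IH -> ->.
Qed.

Lemma trail_incident E es vs e a :
  trail E es vs -> e \in es -> incident e a -> a \in vs.
Proof.
elim: es vs => [|f es IH] [|b vs] //= /and4P[_ tr _ jf].
have szvs := trail_size tr.
rewrite inE => /orP[/eqP -> | ees] inc; last first.
  by rewrite inE (IH _ tr ees inc) orbT.
case: vs szvs jf {tr} => [//|c vs] _ /= jf.
rewrite !inE.
move: jf; rewrite /joins => /orP[] /andP[/eqP <- /eqP <-];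
  by case/orP: inc => /eqP <-; rewrite eqxx ?orbT.
Qed.

Lemma trail_edges_uniq E es vs : trail E es vs -> uniq es.
Proof.
elim: es vs => [|f es IH] [|b vs] //= /and4P[_ tr bvs jf].
rewrite (IH _ tr) andbT; apply: contra bvs => fes.
by apply: (trail_incident tr fes); case/andP: (joins_incident jf).
Qed.

Lemma trail_joins E es vs i e a b : trail E es vs ->
  onth es i = Some e -> onth vs i = Some a -> onth vs i.+1 = Some b ->
  joins e a b.
Proof.
elim: es vs i => [|f es IH] [|c vs] [|i] //= /and4P[_ tr _ jf].
- by move=> [<-] [<-]; case: vs jf {tr} => //= d vs jf [<-].
- exact: IH.
Qed.

Lemma onth_take (T : Type) (s : seq T) k i : (i < k)%N -> onth (take k s) i = onth s i.
Proof. by elim: s k i => [|x s IH] [|k] [|i] //=; rewrite ltnS; apply: IH. Qed.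

Hypothesis Gf : is_forest G.

(** The first [index u vs] edges of the trail lead from [a] to [u], and [e] closes them to a cycle.
    For [u = a] this cycle is a loop. *)
Lemma trail_closed E es vs e a u : trail E es vs -> onth vs 0 = Some a ->
  joins e u a -> e \notin es -> u \in vs -> False.
Proof.
move=> tr v0 jo ees uvs; apply: Gf.
set i := index u vs.
have ivs : (i < size vs)%N by rewrite index_mem.
have ies : (i <= size es)%N by rewrite -ltnS -(trail_size tr).
exists (rcons (take i es) e), (take i.+1 vs).
have szes : size (rcons (take i es) e) = i.+1 by rewrite size_rcons size_takel.
split; rewrite ?szes //.
- by rewrite size_takel.
- rewrite rcons_uniq take_uniq ?(trail_edges_uniq tr) // andbT.
  by apply: contra ees; apply: mem_take.
- by rewrite take_uniq // (trail_uniq tr).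
move=> j f x y hf; have jlt : (j < i.+1)%N.
  by rewrite -szes; case: ltnP hf => // h; rewrite onth_default.
rewrite onth_take // => hx.
move: jlt; rewrite ltnS leq_eqVlt => /orP[/eqP ji|ji].
- subst j; rewrite modnn onth_take // v0 => -[<-].
  move: hf; rewrite -cats1 onth_cat size_takel // ltnn subnn => -[<-].
  by have := @onth_nth _ u _ _ _ hx; rewrite nth_index // => <-.
- rewrite modn_small ?ltnS // onth_take ?ltnS // => hy.
  apply: (trail_joins tr _ hx hy).
  by move: hf; rewrite -cats1 onth_cat size_takel // ji onth_take.
Qed.

(** Without a leaf, trails could be prolonged forever. *)
Lemma exists_leaf E : E != finset.set0 ->
  exists e b, [/\ e \in E, incident e b &
    forall f, f \in E -> incident f b -> f = e].
Proof.
case/finset.set0Pn => e0 e0E; apply: contrapT => noleaf.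
have next e b : e \in E -> incident e b ->
    exists f, [/\ f \in E, incident f b & f != e].
  move=> eE eb; apply: contrapT => H; apply: noleaf; exists e, b; split=> // f fE fb.
  by apply/eqP/negPn/negP => fe; apply: H; exists f.
have noloop e u a : joins e u a -> u != a.
  move=> jo; apply/eqP => ua.
  by apply: (@trail_closed E [::] [:: a] e a u) => //; rewrite ua inE.
have long k : exists es vs, trail E es vs /\ size es = k.+1.
  elim: k => [|k [es [vs [tr sz]]]].
    exists [:: e0], [:: gsrc e0; gdst e0]; split=> //=.
    have jo : joins e0 (gsrc e0) (gdst e0) by rewrite /joins !eqxx.
    by rewrite e0E inE jo (noloop _ _ _ jo).
  case: es sz tr => // e es /= [sz]; case: vs => // a vs /and4P[eE tr avs jo].
  have /andP[ea _] := joins_incident jo.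
  have [f [fE fa fe]] := next _ _ eE ea.
  have [u ju] := incident_joins fa.
  have tr' : trail E (e :: es) (a :: vs) by rewrite /= eE tr avs.
  exists (f :: e :: es), (u :: a :: vs); split; last by rewrite /= sz.
  (* A repeated vertex would close a cycle through [f]. The edge [f] is new: an older edge at [a]
     would put [a] on the older trail. *)
  have Hu : u \notin a :: vs.
    apply/negP; apply: (trail_closed tr' _ ju) => //.
    rewrite inE (negPf fe) /=; apply: contra avs => fes.
    exact: (trail_incident tr fes fa).
  change (is_true [&& f \in E, trail E (e :: es) (a :: vs), u \notin a :: vs & joins f u a]).
  by rewrite fE Hu ju tr'.
have [es [vs [tr sz]]] := long #|gV G|.
have := uniq_leq_size (trail_uniq tr) (fun x _ => mem_enum predT x).
by rewrite -cardE (trail_size tr) sz; rewrite ltnNge leqnSn.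
Qed.

(** Induction on [#|E|]: remove a leaf edge, root the rest, and hang the leaf one level below its
    other end. Injectivity of [child up] leaves each vertex at most one edge towards its root. *)
Lemma forest_rooting_on E : exists (up : gE G -> bool) (depth : gV G -> nat),
  {in E &, injective (child up)} /\
  {in E, forall e, depth (parent up e) < depth (child up e)}%N.
Proof.
have [k] := ubnP #|E|; elim: k E => // k IH E; rewrite ltnS => cE.
have [->|E0] := eqVneq E finset.set0.
  by exists xpredT, (fun=> 0%N); split=> [e f|e]; rewrite inE.
have [e [b [eE eb leaf]]] := exists_leaf E0.
have [|up [depth [inj dlt]]] := IH (E :\ e)%SET.
  by apply: leq_trans cE; apply: proper_card; rewrite properD1.
have nb f : f \in (E :\ e)%SET -> (gsrc f != b) && (gdst f != b).
  rewrite !inE => /andP[fe fE]; rewrite -negb_or; apply: contra fe => /leaf fef.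
  by rewrite fef.
pose up' f := if f == e then gsrc e == b else up f.
have ue : child up' e = b.
  rewrite /child /up' eqxx; case: eqP => // ne; apply/eqP.
  by case/orP: eb => // /eqP /ne.
have pe : parent up' e != b.
  apply/eqP => pb; move: ue pb; rewrite /child /parent /up' eqxx.
  have noloop : gsrc e != b \/ gdst e != b.
    case: (eqVneq (gsrc e) b) => [sb|]; last by left.
    right; apply/eqP => db.
    apply: (@trail_closed E [::] [:: b] e b b) => //; rewrite ?inE //.
    by rewrite /joins sb db eqxx.
  case: (gsrc e =P b) noloop => [sb [/eqP|/eqP] //|ne _ db sb].
  exact: ne.
have same f : f != e -> child up' f = child up f /\ parent up' f = parent up f.
  by move=> /negPf fe; rewrite /child /parent /up' fe.
have cb f : f \in (E :\ e)%SET -> (child up f != b) && (parent up f != b).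
  by rewrite /child /parent => /nb/andP[]; case: (up f) => -> ->.
exists up', (fun a => if a == b then (depth (parent up' e)).+1 else depth a).
split=> [f g fE gE'|f fE].
- have [->|fe] := eqVneq f e; have [->|ge] := eqVneq g e => //.
  + rewrite ue (same g ge).1 => bc.
    by have := cb g; rewrite !inE ge gE' -bc eqxx => /(_ isT).
  + rewrite ue (same f fe).1 => bc.
    by have := cb f; rewrite !inE fe fE bc eqxx => /(_ isT).
  + rewrite (same f fe).1 (same g ge).1; apply: inj; by rewrite !inE ?fe ?ge.
- have [->|fe] := eqVneq f e; first by rewrite ue eqxx (negPf pe).
  have fEe : f \in (E :\ e)%SET by rewrite !inE fe.
  rewrite (same f fe).1 (same f fe).2.
  by have /andP[/negPf -> /negPf ->] := cb f fEe; apply: dlt.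
Qed.

Lemma forest_rooting : exists (up : gE G -> bool) (depth : gV G -> nat),
  injective (child up) /\
  forall e, (depth (parent up e) < depth (child up e))%N.
Proof.
have [up [depth [inj dlt]]] := forest_rooting_on finset.setT.
exists up, depth; split=> [e f|e]; last by apply: dlt; rewrite inE.
by apply: inj; rewrite inE.
Qed.
End Rooting.

(** * Parts cut off by a knife *)

Section RootedForest.
Variables (R : realType) (G : graph R).
Variables (up : gE G -> bool) (depth : gV G -> nat).
Hypothesis child_inj : injective (child up).
Hypothesis depth_lt : forall e, (depth (parent up e) < depth (child up e))%N.

Local Notation ch := (child up).
Local Notation pa := (parent up).
Local Notation vert := (PV (gE G) R).
Local Notation inner := (PE (gV G)).
Local Notation point := (cake_point G).

(** Coordinate measured from the child end, so that going up means increasing height whatever the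
    orientation of the edge. *)
Definition height e (x : R) := if up e then x else glen e - x.
Definition at_height e (h : R) : point := pos e (height e h).

Lemma heightK e : involutive (height e).
Proof. by move=> x; rewrite /height; case: (up e) => //; rewrite opprB addrC subrK. Qed.

Lemma height_itv e x : (0 < height e x < glen e) = (0 < x < glen e).
Proof. by rewrite /height; case: (up e) => //; apply/idP/idP; lra. Qed.

Lemma height_citv e x : (0 <= height e x <= glen e) = (0 <= x <= glen e).
Proof. by rewrite /height; case: (up e) => //; apply/idP/idP; lra. Qed.

Lemma at_height0 e : at_height e 0 = vert (ch e).
Proof.
have /eqP ne := lt0r_neq0 (glen_pos e).
rewrite /at_height /pos /height /child; case: (up e); first by rewrite eqxx.
by rewrite subr0 eqxx; case: eqP.
Qed.

Lemma at_height_len e : at_height e (glen e) = vert (pa e).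
Proof.
have /eqP ne := lt0r_neq0 (glen_pos e).
rewrite /at_height /pos /height /parent; case: (up e); last by rewrite subrr eqxx.
by rewrite eqxx; case: eqP.
Qed.

Lemma pos_inner e x : 0 < x < glen e -> pos e x = inner e x.
Proof. by move=> /andP[x0 xl]; rewrite /pos gt_eqF // lt_eqF. Qed.

Lemma at_height_inner e h : 0 < h < glen e -> at_height e h = inner e (height e h).
Proof. by move=> hh; rewrite /at_height pos_inner // height_itv. Qed.

Lemma inner_at_height e x : 0 < x < glen e -> inner e x = at_height e (height e x).
Proof. by move=> xx; rewrite at_height_inner ?height_itv // heightK. Qed.

Definition below (a w : gV G) : bool :=
  connect [rel a b | [exists e, (ch e == a) && (pa e == b)]] a w.

Lemma below_refl a : below a a.
Proof. exact: connect0. Qed.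

(** By [child_inj], [e] is the only way up from its child end, so every longer climb starts along
    it. *)
Lemma below_child e w : below (ch e) w = (ch e == w) || below (pa e) w.
Proof.
apply/idP/orP => [|[/eqP -> | ]]; last 2 first.
- exact: below_refl.
- by apply: connect_trans; apply: connect1 => /=; apply/existsP; exists e; rewrite !eqxx.
case/connectP => -[/= _ -> | b p /= /andP[/existsP[f /andP[/eqP /child_inj -> /eqP pb]] pp] lp].
  by left.
by right; apply/connectP; exists p; rewrite pb.
Qed.

Lemma below_depth a w : below a w -> (depth w <= depth a)%N.
Proof.
case/connectP => p; elim: p a => [a _ -> //|b p IH a /= /andP[]].
case/existsP => e /andP[/eqP <- /eqP pb] pp lp.
by apply: leq_trans (ltnW (depth_lt e)); rewrite pb; apply: IH.
Qed.

Lemma below_last a w : below a w -> a != w -> exists2 e, pa e = w & below a (ch e).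
Proof.
case/connectP => p; elim/last_ind: p => [_ -> /eqP //|p b _].
rewrite rcons_path last_rcons => /andP[pp /existsP[e /andP[/eqP ce /eqP pe]]] -> _.
by exists e => //; apply/connectP; exists p.
Qed.

(** A knife [(inl w, _)] cuts off the subtree rooted at [w], its real component being
    irrelevant; [(inr e, s)] cuts off the subtree below the edge [e] together with the
    points of [e] of height less than [s]. *)
Definition knife : Type := ((gV G + gE G) * R)%type.

Definition top (c : knife) : gV G := match c.1 with inl w => w | inr e => ch e end.

(** An edge lies wholly in the part as soon as its parent end is below [top c]. The guard
    [0 < x < glen e] discards terms [PE e x] that are no points of the cake. *)
Definition lowset (c : knife) : set point := [set p | match p with
  | PV a => below a (top c)
  | PE e x => (0 < x < glen e) &&
      (below (pa e) (top c) || (c.1 == inr e) && (height e x < c.2))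
  end].

Lemma lowset_at_height c e h : 0 <= h <= glen e -> lowset c (at_height e h) <->
  [|| below (pa e) (top c), (h == 0) && (ch e == top c) |
      [&& 0 < h < glen e, c.1 == inr e & h < c.2]].
Proof.
move=> /andP[]; rewrite le_eqVlt => /predU1P[<- _|h0].
  rewrite at_height0 /lowset /= below_child ltxx eqxx /= orbF orbC //.
rewrite (gt_eqF h0) le_eqVlt => /predU1P[-> |hl].
  by rewrite at_height_len /lowset /= ltxx andbF orbF.
by rewrite at_height_inner ?h0 // /lowset /= height_itv h0 hl heightK.
Qed.

Lemma lowset_down c e h h' : 0 <= h' <= h -> h <= glen e ->
  lowset c (at_height e h) -> lowset c (at_height e h').
Proof.
move=> /andP[h'0 hh'] hl; have h0 := le_trans h'0 hh'.
rewrite !lowset_at_height ?h0 ?h'0 ?hl ?(le_trans hh' hl) //.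
case/or3P => [-> //|/andP[/eqP h00 ce]|/and3P[/andP[hp hlt] ce hs]].
  have h'E : h' = 0 by lra.
  by rewrite h'E eqxx ce orbT.
move: h'0; rewrite le_eqVlt => /predU1P[<-|h'p].
  by rewrite /top (eqP ce) !eqxx !orbT.
by rewrite h'p ce (le_lt_trans hh' hlt) (le_lt_trans hh' hs) !orbT.
Qed.

Section Share.
Variables (I : finType).
Implicit Types (cs : I -> knife) (S : {set I}).

(** [S] stands for the agents served earlier. Whole parts are removed rather than earlier shares, so
    that a share depends on the knives and on [S] alone. *)
Definition rest cs S : set point := [set p | forall j, j \in S -> ~ lowset (cs j) p].
Definition share cs (i : I) S : set point := lowset (cs i) `&` rest cs S.

Lemma rest_up cs S e h h' : 0 <= h' <= h -> h <= glen e ->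
  rest cs S (at_height e h') -> rest cs S (at_height e h).
Proof. by move=> hh hl r j jS /(lowset_down hh hl); apply: r. Qed.

End Share.

(** * Paths inside shares and across the boundary of a part *)

Lemma path_step_at_height (X : set point) e h1 h2 :
  0 <= h1 <= glen e -> 0 <= h2 <= glen e ->
  (forall h, Num.min h1 h2 <= h <= Num.max h1 h2 -> X (at_height e h)) ->
  path_step X (at_height e h1) (at_height e h2).
Proof.
move=> h1P h2P XP; exists e, (height e h1), (height e h2).
rewrite !height_citv; split=> // t tP.
rewrite -[t](heightK e); apply: XP.
move: tP; rewrite /height; case: (up e) => //.
by rewrite /Num.min /Num.max; do ![case: ifP]; lra.
Qed.

Lemma path_stepP (X : set point) p q : path_step X p q ->
  exists e h1 h2, [/\ 0 <= h1 <= glen e, 0 <= h2 <= glen e,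
    p = at_height e h1, q = at_height e h2 &
    forall h, Num.min h1 h2 <= h <= Num.max h1 h2 -> X (at_height e h)].
Proof.
move=> [e [a [b [aP bP -> -> XP]]]]; exists e, (height e a), (height e b).
rewrite !height_citv /at_height !heightK; split=> // t tP.
apply: XP; move: tP; rewrite /height; case: (up e) => //.
by rewrite /Num.min /Num.max; do ![case: ifP]; lra.
Qed.

Local Notation reach X := (clos_refl_trans point (path_step X)).

Lemma reach_sym (X : set point) p q : reach X p q -> reach X q p.
Proof.
elim=> [x y xy|x|x y z _ xy _ yz]; [apply: rt_step|exact: rt_refl|exact: rt_trans yz xy].
have [e [a [b [aP bP -> -> XP]]]] := xy.
exists e, b, a; split=> // t tP; apply: XP.
by rewrite minC maxC.
Qed.

(** Shares are upward closed inside the part cut off, so one can climb inside them. *)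
Lemma share_connected (I : finType) (cs : I -> knife) i S :
  connected_piece (share cs i S).
Proof.
set X := share cs i S; set c := cs i.
have toparent e h : 0 <= h <= glen e -> X (at_height e h) -> below (pa e) (top c) ->
    reach X (at_height e h) (vert (pa e)) /\ X (vert (pa e)).
  move=> /andP[h0 hl] Xh bel.
  have XP k : h <= k <= glen e -> X (at_height e k).
    move=> /andP[hk kl]; split.
      by apply/lowset_at_height; rewrite ?bel // kl (le_trans h0 hk).
    by apply: rest_up Xh.2; rewrite ?h0.
  rewrite -at_height_len; split; last by apply: XP; rewrite hl lexx.
  apply: rt_step; apply: path_step_at_height;
    rewrite ?h0 ?hl ?(ltW (glen_pos e)) ?lexx //.
  by move=> k; rewrite min_l // max_r //; apply: XP.
have climbV a : X (vert a) -> reach X (vert a) (vert (top c)) /\ X (vert (top c)).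
  have [k] := ubnP (depth a); elim: k a => // k IH a; rewrite ltnS => da Xa.
  have [aE|atop] := eqVneq a (top c).
    by rewrite -aE; split=> //; apply: rt_refl.
  have := Xa.1; rewrite /lowset /= => /connectP[[/= _ h|b p /=]].
    by rewrite h eqxx in atop.
  case/andP => /existsP[e /andP[/eqP ea /eqP eb]] pp lp.
  have bel : below (pa e) (top c) by apply/connectP; exists p; rewrite eb.
  have Xe0 : X (at_height e 0) by rewrite at_height0 ea.
  have e0P : (0 : R) <= 0 <= glen e by rewrite lexx ltW ?glen_pos.
  have [r Xp] := toparent e 0 e0P Xe0 bel.
  have dpa : (depth (pa e) < k)%N by apply: leq_trans da; rewrite -ea.
  have [r' Xt] := IH (pa e) dpa Xp.
  by split=> //; apply: rt_trans r'; rewrite -ea -at_height0.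
(* A point on the edge of the knife is left where it is: [top c] may already belong to an earlier
   part. *)
have climb p : X p -> exists q, [/\ X q, reach X p q & q = vert (top c) \/
    exists e h, [/\ c.1 = inr e, 0 < h < glen e, h < c.2 & q = at_height e h]].
  case: p => [a /climbV[r Xt]|e x Xp]; first by exists (vert (top c)); split=> //; left.
  have := Xp.1; rewrite /lowset /= => /andP[xP]; have hP := xP; rewrite -height_itv in hP.
  have [bel _|_ /= /andP[/eqP ce xs]] := boolP (below _ _); last first.
    exists (inner e x); split=> //; first exact: rt_refl.
    by right; exists e, (height e x); rewrite -inner_at_height.
  have hP' : 0 <= height e x <= glen e by case/andP: hP => h0 hl; rewrite !ltW.
  have Xh : X (at_height e (height e x)) by rewrite -inner_at_height.
  have [r Xpa] := toparent e (height e x) hP' Xh bel.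
  have [r' Xt] := climbV _ Xpa.
  exists (vert (top c)); split=> //; last by left.
  by apply: rt_trans r'; rewrite inner_at_height.
have along e h k : c.1 = inr e -> 0 <= h <= k -> k < glen e -> k < c.2 ->
    X (at_height e h) -> reach X (at_height e h) (at_height e k).
  move=> ce /andP[h0 hk] kl ks Xh; have k0 := le_trans h0 hk.
  apply: rt_step; apply: path_step_at_height;
    rewrite ?h0 ?k0 ?(ltW kl) ?(le_trans hk (ltW kl)) //.
  move=> l; rewrite min_l // max_r // => /andP[hl lk].
  split; last by apply: rest_up Xh.2; rewrite ?h0 // (le_trans lk (ltW kl)).
  have ll := le_lt_trans lk kl.
  apply/lowset_at_height; first by rewrite (le_trans h0 hl) ltW.
  have := le_trans h0 hl; rewrite le_eqVlt => /predU1P[<-|l0].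
    by rewrite /top -/c ce !eqxx /= orbT.
  by rewrite l0 ll -/c ce eqxx (le_lt_trans lk ks) !orbT.
have toptop p q : X p -> X q -> (p = vert (top c) \/
    exists e h, [/\ c.1 = inr e, 0 < h < glen e, h < c.2 & p = at_height e h]) ->
    (q = vert (top c) \/
    exists e h, [/\ c.1 = inr e, 0 < h < glen e, h < c.2 & q = at_height e h]) ->
    reach X p q.
  have up0 e h : c.1 = inr e -> 0 < h < glen e -> h < c.2 -> X (vert (top c)) ->
      reach X (vert (top c)) (at_height e h).
    move=> ce /andP[h0 hl] hs; rewrite /top ce -at_height0; apply: along => //.
    by rewrite lexx ltW.
  move=> Xp Xq [pE|[e [h [ce hP hs pE]]]] [qE|[f [k [cf kP ks qE]]]]; subst p q.
  - exact: rt_refl.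
  - exact: up0.
  - by apply: reach_sym; apply: up0.
  - move: cf; rewrite ce => -[ef]; subst f.
    have [hk|kh] := leP h k.
    + by apply: along => //; lra.
    + by apply: reach_sym; apply: along => //; lra.
move=> p q /climb[p' [Xp' rp pP]] /climb[q' [Xq' rq qP]].
apply: rt_trans rp _; apply: rt_trans (reach_sym rq).
exact: toptop.
Qed.

(** Some step of a path in [X] leaves the part. It goes upwards because the part is closed
    downwards, and its edge starts at [top c] because an edge whose parent end is below [top c] lies
    in the part. *)
Lemma crossing (X : set point) c p q : connected_piece X ->
  X p -> lowset c p -> X q -> ~ lowset c q ->
  exists e h1 h2, [/\ 0 <= h1 < h2, h2 <= glen e, ch e = top c,
    forall h, h1 <= h <= h2 -> X (at_height e h) &
    ~ lowset c (at_height e h2) /\ (h1 = 0 \/ c.1 = inr e /\ h1 < c.2)].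
Proof.
move=> conn Xp cp Xq ncq; have r := conn p q Xp Xq.
have {Xp Xq r} : exists p' q', [/\ path_step X p' q', lowset c p' & ~ lowset c q'].
  elim: r cp ncq {Xp Xq} => [x y xy cx cy|x cx /(_ cx) //|x y z _ IH1 _ IH2 cx cz].
    by exists x, y.
  by have [cy|cy] := pselect (lowset c y); [apply: IH2|apply: IH1].
move=> [p' [q' [/path_stepP[e [h1 [h2 [h1P h2P -> -> XP]]]] c1 c2]]].
have h12 : h1 < h2.
  rewrite ltNge; apply/negP => h21; apply: c2; apply: lowset_down c1; lra.
exists e, h1, h2; move: c1 => /(lowset_at_height c h1P) c1.
have nb : ~~ below (pa e) (top c).
  by apply/negP => bel; apply: c2; apply/(lowset_at_height c h2P); rewrite bel.
rewrite (negPf nb) /= in c1.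
split; [lra|lra| | |].
- case/orP: c1 => [/andP[_ /eqP] //|/and3P[_ /eqP ce _]].
  by rewrite /top ce.
- by move=> h hP; apply: XP; rewrite min_l ?max_r ?(ltW h12).
- split=> //; case/orP: c1 => [/andP[/eqP -> _]|/and3P[_ /eqP ce hs]]; first by left.
  by right.
Qed.

(** The only exit of a subtree is its top vertex; the edge found there shows that [w] is not a
    root. *)
Lemma crossing_vertex (X : set point) w s p q : connected_piece X ->
  X p -> lowset (inl w, s) p -> X q -> ~ lowset (inl w, s) q ->
  X (vert w) /\ exists e, ch e = w.
Proof.
move=> conn Xp cp Xq cq.
have [e [h1 [h2 [h12 _ ew XP [_ [h10|[]//]]]]]] := crossing conn Xp cp Xq cq.
rewrite /top /= in ew; rewrite -ew.
split; last by exists e.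
by rewrite -at_height0; apply: XP; lra.
Qed.

(** By injectivity of [ch] the exit is on [e] itself, where [X] covers an interval of heights
    containing [s]. *)
Lemma crossing_edge (X : set point) e s p q : connected_piece X ->
  0 <= s <= glen e ->
  X p -> lowset (inr e, s) p -> X q -> ~ lowset (inr e, s) q ->
  X (at_height e s).
Proof.
move=> conn sP Xp cp Xq cq.
have [f [h1 [h2 [h12 h2l tf XP [nc hs]]]]] := crossing conn Xp cp Xq cq.
move: tf; rewrite /top /= => /child_inj fe; subst f.
apply: XP; apply/andP; split; first by case: hs => [->|[_ /= /ltW]] //; case/andP: sP.
rewrite leNgt; apply/negP => h2s; apply: nc.
apply/lowset_at_height; first by lra.
by rewrite /= eqxx h2s; apply/or3P/Or33; lra.
Qed.

(** Without [w], its subtree splits into branches; the knife [(inr e, glen e)] cuts off the branch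
    of [e] but not [w]. *)
Lemma lowset_branch w s p : lowset (inl w, s) p -> p <> vert w ->
  exists2 e, pa e = w & lowset (inr e, glen e) p.
Proof.
case: p => [a|e x]; rewrite /lowset /top /=.
  move=> aw ne; have [|e pe ae] := below_last aw; last by exists e.
  by apply/eqP => h; apply: ne; rewrite h.
rewrite orbF => /andP[xP bel] _.
have [pe|pe] := eqVneq (pa e) w.
  by exists e => //; rewrite xP eqxx; move: xP; rewrite -height_itv => /andP[_ ->]; rewrite orbT.
have [f pf bf] := below_last bel pe.
by exists f => //; rewrite xP bf.
Qed.

End RootedForest.

(** * Continuity in the knife positions *)

Section EdgewiseIntervals.
Variables (R : realType) (G : graph R) (up : gE G -> bool).

Local Notation vert := (PV (gE G) R).
Local Notation inner := (PE (gV G)).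
Local Notation point := (cake_point G).

(** Stronger than [is_piece]: a single interval per edge is a form preserved by all the operations
    that build a share. *)
Definition edgewise_itv (X : set point) := exists J : gE G -> interval R,
  forall e x, X (inner e x) <-> (0 < x < glen e) && (x \in J e).

Lemma edgewise_itv_piece (X : set point) : edgewise_itv X -> is_piece X.
Proof.
move=> [J XJ].
exists [set a | `[<X (vert a)>]]%SET.
exists [seq (e, Order.meet (J e) `]0, (glen e)[) | e <- enum (gE G)].
split=> [p /mapP[e _ ->]|].
  move=> t /= tP; move: tP; rewrite in_itvI [X in _ && X]in_itv => /andP[_ /andP[t0 tl]].
  by rewrite !ltW.
apply/seteqP; split=> [[a Xa|e x Xx]|q [[a /= aW <-]|[p]]].
- by left; exists a => //=; rewrite inE; apply/asboolP.
- right; have /XJ/andP[xP xJ] := Xx.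
  exists (e, Order.meet (J e) `]0, (glen e)[).
    by apply/mapP; exists e; rewrite ?mem_enum.
  by exists x; rewrite ?pos_inner //= in_itvI xJ [X in _ && X]in_itv.
- by move: aW; rewrite inE => /asboolP.
- move=> /mapP[e _ ->] [t /=]; rewrite in_itvI [X in _ && X]in_itv => /andP[tJ tP] ->.
  by rewrite pos_inner //; apply/XJ; rewrite tP tJ.
Qed.

Lemma edgewise_itv_measurable (X : set point) e : edgewise_itv X ->
  measurable [set x | 0 < x < glen e /\ X (inner e x)].
Proof.
move=> [J XJ].
have -> : [set x | 0 < x < glen e /\ X (inner e x)] =
    [set` `]0, (glen e)[] `&` [set` J e].
  apply/seteqP; split=> x /=; rewrite in_itv /=.
  - by move=> [xP] /XJ /andP[].
  - by move=> [xP xJ]; split=> //; apply/XJ; rewrite xP.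
exact: measurableI.
Qed.

(** The knife meets an edge at most once, so that the complement of the part is an interval on the
    edge as well. *)
Lemma lowset_itv c e : exists H H' : interval R, forall x, 0 < x < glen e ->
  (lowset up c (inner e x) <-> x \in H) /\ (~ lowset up c (inner e x) <-> x \in H').
Proof.
case bel : (below up (parent up e) (top up c)).
  exists `]-oo, +oo[, `]0, 0[ => x xP.
  by rewrite /lowset /= xP bel !in_itv /=; split=> //; split=> //; lra.
case ce : (c.1 == inr e); last first.
  exists `]0, 0[, `]-oo, +oo[ => x xP.
  by rewrite /lowset /= xP bel ce !in_itv /=; split=> //; split=> //; lra.
case upe : (up e).
  exists `]-oo, c.2[, `[c.2, +oo[ => x xP.
  rewrite /lowset /= xP bel ce !in_itv /= /height upe andbT; split=> //.
  by rewrite leNgt; split=> /negP.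
exists `](glen e - c.2), +oo[, `]-oo, (glen e - c.2)] => x xP.
rewrite /lowset /= xP bel ce !in_itv /= /height upe andbT.
by split; split; [lra|lra|move=> /negP|move=> ? ?]; lra.
Qed.

Lemma edgewise_itv_lowsetD (X : set point) c : edgewise_itv X ->
  edgewise_itv (X `&` lowset up c) /\ edgewise_itv (X `&` ~` lowset up c).
Proof.
move=> [J XJ]; have /choice[H /choice[H' HP]] := lowset_itv c.
split.
  exists (fun e => Order.meet (J e) (H e)) => e x; rewrite in_itvI; split.
    move=> [/XJ/andP[xP xJ] cx]; rewrite xP xJ /=.
    by have [<- _] := HP e x xP.
  move=> /and3P[xP xJ xH]; split; first by apply/XJ; rewrite xP.
  by have [-> _] := HP e x xP.
exists (fun e => Order.meet (J e) (H' e)) => e x; rewrite in_itvI; split.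
  move=> [/XJ/andP[xP xJ] cx]; rewrite xP xJ /=.
  by have [_ <-] := HP e x xP.
move=> /and3P[xP xJ xH]; split; first by apply/XJ; rewrite xP.
by have [_ h] := HP e x xP; apply/h.
Qed.

Lemma edgewise_itv_share (I : finType) (cs : I -> knife G) i S :
  edgewise_itv (share up cs i S).
Proof.
pose Y (s : seq I) : set point :=
  lowset up (cs i) `&` [set p | forall j, j \in s -> ~ lowset up (cs j) p].
have YP s : edgewise_itv (Y s).
  elim: s => [|j s [J YJ]].
    have full : edgewise_itv [set p : point | match p with
        | PV _ => True | PE e x => 0 < x < glen e end].
      by exists (fun=> `]-oo, +oo[) => e x /=; rewrite in_itv /= andbT.
    have [[J HJ] _] := edgewise_itv_lowsetD (cs i) full.
    exists J => e x; rewrite -HJ /Y; split; last by move=> [_ h]; split.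
    by move=> [h _]; split=> //; move: h; rewrite /lowset /= => /andP[].
  have [_ [J' HJ']] := edgewise_itv_lowsetD (cs j) (ex_intro _ J YJ).
  exists J' => e x; rewrite -HJ' /Y; split=> [[h1 h2]|[[h1 h2] h3]].
    split; last by apply: h2; rewrite inE eqxx.
    by split=> // k ks; apply: h2; rewrite inE ks orbT.
  by split=> // k; rewrite inE => /predU1P[->|]; [|apply: h2].
have [J YJ] := YP (enum S); exists J => e x; rewrite -YJ /share /rest /Y.
by split=> -[h1 h2]; split=> // j; move: (h2 j); rewrite /= mem_enum.
Qed.

Lemma share_piece (I : finType) (cs : I -> knife G) i S : is_piece (share up cs i S).
Proof. exact/edgewise_itv_piece/edgewise_itv_share. Qed.

(** Membership changes only for points whose height lies between the two knife positions. *)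
Lemma lowset_close (c c' : knife G) (eta : R) e x : c'.1 = c.1 -> `|c'.2 - c.2| < eta ->
  ~ (lowset up c (inner e x) <-> lowset up c' (inner e x)) ->
  `|height up e c.2 - x| < eta.
Proof.
move=> cc; rewrite /lowset /top /= cc.
case: (0 < x < glen e); last by move=> _ [].
case: (below _ _ _); first by move=> _ [].
case: (c.1 == inr e); last by move=> _ [].
rewrite /=.
have -> : `|height up e c.2 - x| = `|c.2 - height up e x|.
  by rewrite /height; case: (up e) => //; rewrite -normrN; congr `|_|; lra.
set y := height up e x.
rewrite !ltr_norml => eP ne; case: (ltP y c.2) ne; case: (ltP y c'.2) => h1 h2 ne;
  first by case: ne.
- lra.
- lra.
- by case: ne.
Qed.

Lemma share_symdiff (I : finType) (cs cs' : I -> knife G) i S (eta : R) e :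
  (forall j, (cs' j).1 = (cs j).1) -> (forall j, `|(cs' j).2 - (cs j).2| < eta) ->
  let X := share up cs i S in let Y := share up cs' i S in
  [set x | 0 < x < glen e /\ ((X `\` Y) `|` (Y `\` X)) (inner e x)] `<=`
    \bigcup_(j in [set: I]) ball (height up e (cs j).2) eta.
Proof.
move=> e1 e2 X Y x [_ xXY]; apply: contrapT => H.
have E j : lowset up (cs j) (inner e x) <-> lowset up (cs' j) (inner e x).
  apply: contrapT => nE; apply: H; exists j => //.
  by rewrite /ball /=; apply: (lowset_close (e1 j) (e2 j) nE).
have EX : X (inner e x) <-> Y (inner e x).
  by split=> -[h1 h2]; (split; first exact/E) => j jS /E; apply: h2.
by case: xXY => -[h1 h2]; apply: h2; apply/EX.
Qed.

Lemma share_glength (I : finType) (cs cs' : I -> knife G) i S (eta : R) : 0 <= eta ->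
  (forall j, (cs' j).1 = (cs j).1) -> (forall j, `|(cs' j).2 - (cs j).2| < eta) ->
  (glength ((share up cs i S `\` share up cs' i S) `|`
            (share up cs' i S `\` share up cs i S)) <=
   ((eta *+ 2) *+ #|I| *+ #|gE G|)%:E)%E.
Proof.
move=> eta0 e1 e2; rewrite /glength.
apply: (@le_trans _ _ (\sum_(e : gE G) ((eta *+ 2) *+ #|I|)%:E)%E); last first.
  by rewrite sumEFin sumr_const lexx.
apply: lee_sum => e _.
set A := [set x | _].
have mA : measurable A.
  have mX := edgewise_itv_measurable e (edgewise_itv_share cs i S).
  have mY := edgewise_itv_measurable e (edgewise_itv_share cs' i S).
  have -> : A = ([set x | 0 < x < glen e /\ share up cs i S (inner e x)] `\`
       [set x | 0 < x < glen e /\ share up cs' i S (inner e x)]) `|`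
      ([set x | 0 < x < glen e /\ share up cs' i S (inner e x)] `\`
       [set x | 0 < x < glen e /\ share up cs i S (inner e x)]).
    apply/seteqP; split=> x /=; rewrite /A /=; tauto.
  by apply: measurableU; apply: measurableD.
pose B k := ball (height up e (cs (nth i (enum I) k)).2) eta.
apply: (@le_trans _ _ (\sum_(k < #|I|) lebesgue_measure (B k))%E).
  apply: content_subadditive => //; first by move=> k _; rewrite /B ball_itv; exact: measurable_itv.
  move=> x /(share_symdiff e1 e2)[j _ jx].
  rewrite -bigcup_mkord; exists (enum_rank j) => //=.
  by rewrite /B nth_enum_rank.
rewrite (eq_bigr (fun=> (eta *+ 2)%:E)) => [|k _].
  by rewrite sumEFin sumr_const card_ord.
by rewrite lebesgue_measure_ball.
Qed.

(** Since the discrete components of the knives are kept, all vertices stay in place, and only short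
    stretches of edges enter or leave the share. *)
Lemma share_continuous v (I : finType) (cs : I -> knife G) i S (eps : R) :
  valuation v -> 0 < eps -> exists2 eta : R, 0 < eta & forall cs' : I -> knife G,
    (forall j, (cs' j).1 = (cs j).1) -> (forall j, `|(cs' j).2 - (cs j).2| < eta) ->
    `|v (share up cs' i S) - v (share up cs i S)| < eps.
Proof.
move=> [_ _ vc _] eps0.
have [delta delta0 D] := vc _ (share_piece cs i S) _ eps0.
(* [K * eta] bounds the length of the symmetric difference; dividing by [K + 1] makes the bound
   strict and is safe even without edges. *)
pose K : R := (2 * #|I| * #|gE G|)%:R.
have K0 : 0 <= K by rewrite ler0n.
have eta0 : 0 < delta / (K + 1) by rewrite divr_gt0 // ltr_wpDl.
exists (delta / (K + 1)) => // cs' e1 e2.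
apply: D; first exact: share_piece.
apply: (le_lt_trans (share_glength i S (ltW eta0) e1 e2)).
rewrite lte_fin -!mulrnA mulnA -[X in X < _]mulr_natr -/K mulrAC ltr_pdivrMr ?ltr_wpDl //.
by rewrite ltr_pM2l // ltrDl.
Qed.

End EdgewiseIntervals.

(** * The moving knife *)

Section MovingKnife.
Variables (R : realType) (G : graph R).
Variables (up : gE G -> bool) (depth : gV G -> nat).
Hypothesis child_inj : injective (child up).
Hypothesis depth_lt : forall e, (depth (parent up e) < depth (child up e))%N.

Local Notation ch := (child up).
Local Notation pa := (parent up).
Local Notation vert := (PV (gE G) R).
Local Notation inner := (PE (gV G)).
Local Notation point := (cake_point G).
Local Notation low := (lowset up).
Local Notation at_height := (at_height up).
Local Notation rst := (rest up).
Local Notation shr := (share up).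

(** Being a piece excludes terms [PE e x] outside the cake; any genuine point is below some
    vertex. *)
Lemma piece_below (X : set point) p : is_piece X -> X p ->
  exists w, low (inl w, 0) p.
Proof.
move=> [W [J [JP ->]]] [[a /= _ <-]|[[e i] ei [x xi ->]]].
  by exists a; rewrite /lowset /= below_refl.
exists (pa e); rewrite -[x](heightK up e) -/(at_height e _).
by apply/lowset_at_height; rewrite ?height_citv ?(JP _ ei) //= below_refl.
Qed.

Lemma lowset_parent e : low (inl (ch e), 0) `<=` low (inl (pa e), 0).
Proof.
have tr a : below up a (ch e) -> below up a (pa e).
  move=> h; apply: connect_trans h _; apply: connect1 => /=.
  by apply/existsP; exists e; rewrite !eqxx.
by case=> [a|f x]; rewrite /lowset /top /= ?orbF; [|case/andP=> -> ]; apply: tr.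
Qed.

Lemma lowset_edge_le e (s s' : R) : s <= s' ->
  low (inr e, s) `<=` low (inr e, s').
Proof.
move=> ss' [a|f x]; rewrite /lowset /top //= => /andP[-> /orP[->//|/andP[->]]].
by move=> /lt_le_trans ->; rewrite ?orbT.
Qed.

Lemma lowset_edge0 e : low (inr e, 0) = low (inl (ch e), 0).
Proof.
apply/seteqP; split=> -[a|f x]; rewrite /lowset /top //= orbF.
  case/andP=> xP /orP[-> |/andP[_ h]]; rewrite ?xP //.
  by move: xP; rewrite -(height_itv up) => /andP[h0 _]; lra.
by case/andP=> -> ->.
Qed.

(** The strict inequality in [lowset] makes the part at [s] the union of the parts at smaller
    positions. *)
Lemma lowset_edge_left e (s : R) p : 0 < s -> low (inr e, s) p ->
  exists2 s1, 0 <= s1 < s & low (inr e, s1) p.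
Proof.
move=> s0; case: p => [a|f x]; rewrite /lowset /top /=.
  by move=> h; exists 0; rewrite ?lexx.
case/andP=> xP /orP[bel|/andP[ef hs]].
  by exists 0; rewrite ?lexx // xP bel.
have := xP; rewrite -(height_itv up) => /andP[h0 _].
exists ((height up f x + s) / 2); first by lra.
rewrite height_itv xP ef /=; apply/orP; right; lra.
Qed.

Section Agents.
Variables (I : finType) (v : I -> set point -> R).
Hypothesis vP : forall i, valuation (v i).
Implicit Types (cs : I -> knife G) (S : {set I}).

Definition update cs i c : I -> knife G := fun j => if j == i then c else cs j.

Lemma rest_ext cs cs' S : {in S, cs =1 cs'} -> rst cs S = rst cs' S.
Proof.
move=> E; apply/seteqP; split=> p r j jS; first by rewrite -E //; apply: r.
by rewrite E //; apply: r.
Qed.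

Lemma share_update cs i c S : i \notin S ->
  shr (update cs i c) i S = low c `&` rst cs S.
Proof.
move=> iS; rewrite /share /update eqxx; congr (_ `&` _).
by apply: rest_ext => j jS /=; case: eqP iS => // <-; rewrite jS.
Qed.

Lemma share_update_neq cs i c j S : i \notin S -> j != i ->
  shr (update cs i c) j S = shr cs j S.
Proof.
move=> iS ji; rewrite /share /update (negPf ji); congr (_ `&` _).
by apply: rest_ext => k kS /=; case: eqP iS => // <-; rewrite kS.
Qed.

Variables (t : I -> R) (cs : I -> knife G) (S : {set I}).

Definition worthy (X : set point) j :=
  [/\ is_piece X, connected_piece X, X `<=` rst cs S & t j <= v j X].

Let g c := low c `&` rst cs S.

(** The knife stops either at a deepest vertex [w] whose subtree is worth [t i] to
    some agent, or earlier, at the first such position on an edge below [w].  In the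
    last conclusion the common point is [w], respectively a point just below the
    knife. *)
Lemma knife_step (a0 : gV G) i0 : i0 \notin S ->
  (forall i, i \notin S -> exists X, worthy X i) ->
  exists i c, [/\ i \notin S, t i <= v i (g c),
    0 <= c.2 <= \sum_(e : gE G) glen e &
    forall j A B, j \notin S -> worthy A j -> worthy B j ->
      A `&` low c !=set0 -> B `&` low c !=set0 -> A `&` B !=set0].
Proof.
move=> i0S ex.
have gpiece c : is_piece (g c) by rewrite /g -(share_update cs c i0S); exact: share_piece.
have gle i c c' : low c `<=` low c' -> v i (g c) <= v i (g c').
  move=> cc'; have [_ mono _ _] := vP i; apply: mono => // p [cp rp].
  by split=> //; apply: cc'.
have worthy_le X j c : worthy X j -> X `<=` low c -> t j <= v j (g c).
  move=> [pX _ Xr tX] Xc; apply: (le_trans tX).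
  by have [_ mono _ _] := vP j; apply: mono => // p Xp; split; [apply: Xc|apply: Xr].
pose bad w := `[<exists2 j, j \notin S & t j <= v j (g (inl w, 0))>].
have [w0 w0bad] : exists w, bad w.
  have [X wX] := ex _ i0S; have [pX cX _ _] := wX.
  suff [r Xr] : exists r, X `<=` low (inl r, 0).
    by exists r; apply/asboolP; exists i0 => //; apply: worthy_le wX Xr.
  have [[p Xp]|X0] := pselect (X !=set0); last first.
    by exists a0 => p Xp; case: X0; exists p.
  have [w wp] := piece_below pX Xp.
  have Pw : `[<low (inl w, 0) p>] by apply/asboolP.
  (* The shallowest vertex above [p] is the root of its tree: a piece leaving its subtree would
     reveal an edge above it. *)
  case: (@arg_minnP _ w (fun w => `[<low (inl w, 0) p>]) depth Pw).
  move=> r /asboolP rp rmin; exists r => q Xq; apply: contrapT => nq.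
  have [_ [e er]] := crossing_vertex child_inj cX Xp rp Xq nq.
  subst r; suff /rmin : `[<low (inl (pa e), 0) p>] by rewrite leqNgt depth_lt.
  by apply/asboolP; exact: lowset_parent.
case: (@arg_maxnP _ w0 bad depth w0bad) => w /asboolP[i iS ti] wmax.
have nobad e j : pa e = w -> j \notin S -> v j (g (inr e, 0)) < t j.
  move=> pe jS; rewrite ltNge; apply/negP => tj.
  suff /wmax : bad (ch e) by rewrite /= -pe leqNgt depth_lt.
  by apply/asboolP; exists j => //; rewrite /g -lowset_edge0.
have sum_ge0 : 0 <= \sum_(e : gE G) glen e by apply: sumr_ge0 => e _; exact: ltW (glen_pos e).
have [[e [j0 [pe j0S tj0]]]|nobranch] := pselect (exists e j, [/\ pa e = w, j \notin S &
    t j <= v j (g (inr e, glen e))]); last first.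
  exists i, (inl w, 0); split=> //; first by rewrite lexx.
  (* A connected piece avoiding [w] would stay inside one branch at [w], and no branch is worth
     enough. *)
  have atw j A : j \notin S -> worthy A j -> A `&` low (inl w, 0) !=set0 -> A (vert w).
    move=> jS wA [p [Ap lp]]; apply: contrapT => nAw.
    have [pA cA _ _] := wA.
    have [|e pe ep] := lowset_branch lp; first by move=> pw; apply: nAw; rewrite -pw.
    apply: nobranch; exists e, j; split=> //; apply: worthy_le wA _ => q Aq.
    apply: contrapT => nq; apply: nAw; rewrite -pe -at_height_len.
    by apply: (crossing_edge child_inj cA _ Ap ep Aq nq); rewrite lexx ltW ?glen_pos.
  move=> j A B jS wA wB mA mB; exists (vert w).
  by split; [apply: atw wA mA|apply: atw wB mB].
have l0 := glen_pos e.
pose E := [set s : R | 0 <= s <= glen e /\ forall j, j \notin S -> v j (g (inr e, s)) < t j].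
have E0 : E 0.
  by split; [rewrite lexx ltW|move=> j jS; apply: nobad].
have Eub : ubound E (glen e) by move=> s [/andP[]].
have hsE : has_sup E by split; [exists 0|exists (glen e)].
pose s := sup E.
have s0 : 0 <= s by apply: sup_upper_bound.
have sl : s <= glen e by apply: ge_sup => //; exists 0.
have below_s s1 j : s1 < s -> j \notin S -> v j (g (inr e, s1)) < t j.
  move=> s1s jS; have d0 : 0 < s - s1 by rewrite subr_gt0.
  have [s2 [_ Es2]] := sup_adherent d0 hsE; rewrite -/s => s12.
  by apply: le_lt_trans (Es2 j jS); apply: gle; apply: lowset_edge_le; lra.
(* Otherwise continuity, for finitely many agents, would put a larger position into [E]. There is
   room above [s], as [j0] is content with the whole branch. *)
have [i' i'S ti'] : exists2 i, i \notin S & t i <= v i (g (inr e, s)).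
  apply: contrapT => H.
  have lt_s j : j \notin S -> v j (g (inr e, s)) < t j.
    by move=> jS; rewrite ltNge; apply/negP => tj; apply: H; exists j.
  have s_lt : s < glen e.
    rewrite lt_neqAle sl andbT; apply/eqP => se.
    by have := lt_s j0 j0S; rewrite se; lra.
  have near_s : \forall x \near s, forall j, j \notin S -> v j (g (inr e, x)) < t j.
    apply: (@filter_forall R I (fun j x => j \notin S -> v j (g (inr e, x)) < t j) (nbhs s) _) => j.
    have [jS|/negPn jS] := boolP (j \notin S); last first.
      by apply: nearW => x; case/negP.
    have d0 : 0 < t j - v j (g (inr e, s)) by rewrite subr_gt0 lt_s.
    have [eta eta0 Heta] := share_continuous up (update cs j (inr e, s)) j S (vP j) d0.
    apply/nbhs_ballP; exists eta => //= x; rewrite /ball /= => xs _.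
    have := Heta (update cs j (inr e, x)); rewrite !share_update // -!/(g _).
    move=> H1; have {H1} : `|v j (g (inr e, x)) - v j (g (inr e, s))| < t j - v j (g (inr e, s)).
      apply: H1 => k; rewrite /update; case: (k == j) => //=.
        by rewrite distrC.
      by rewrite subrr normr0.
    by rewrite ltr_norml => /andP[_]; rewrite ltrBlDr subrK.
  move: near_s => /nbhs_ballP[d /= d0 Hd].
  (* This position is within distance [d] of [s] and does not pass the end of the edge. *)
  pose x := s + Num.min (d / 2) (glen e - s).
  have m0 : 0 < Num.min (d / 2) (glen e - s) by rewrite lt_min divr_gt0 //= subr_gt0.
  have m1 : Num.min (d / 2) (glen e - s) <= d / 2 by rewrite ge_min lexx.
  have m2 : Num.min (d / 2) (glen e - s) <= glen e - s by rewrite ge_min lexx orbT.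
  have Ex : E x.
    split; first by rewrite /x; lra.
    apply: Hd; rewrite /ball /= distrC /x addrC addKr gtr0_norm //; lra.
  by have := sup_upper_bound hsE Ex; rewrite -/s /x; lra.
(* At height 0 only the subtree of [ch e] is cut off, and this vertex is deeper than [w], hence not
   bad. *)
have sp : 0 < s.
  rewrite lt_neqAle s0 andbT; apply/eqP => se.
  by have := nobad e i' pe i'S; rewrite se; lra.
exists i', (inr e, s); split=> //=.
  rewrite s0 (le_trans sl) // (bigD1 e) //= lerDl.
  by apply: sumr_ge0 => f _; exact: ltW (glen_pos f).
move=> j A B jS wA wB [p [Ap lp]] [q [Bq lq]].
(* Both points are already cut off at some [s3 < s], where the part satisfies nobody; so neither
   piece fits below [s3], and both contain that position. *)
have [s1 s1P lp1] := lowset_edge_left sp lp.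
have [s2 s2P lq2] := lowset_edge_left sp lq.
pose s3 := Num.max s1 s2.
have s13 : s1 <= s3 by rewrite le_max lexx.
have s23 : s2 <= s3 by rewrite le_max lexx orbT.
have s3s : s3 < s by rewrite gt_max; lra.
have s3P : 0 <= s3 <= glen e by lra.
have at_s3 X x : worthy X j -> X x -> low (inr e, s3) x -> X (at_height e s3).
  move=> wX Xx lx; have [_ cX _ _] := wX; apply: contrapT => nX.
  have := below_s s3 j s3s jS; rewrite ltNge => /negP; apply.
  apply: worthy_le wX _ => y Xy; apply: contrapT => ny; apply: nX.
  by apply: (crossing_edge child_inj cX s3P Xx lx Xy ny).
exists (at_height e s3); split.
- by apply: at_s3 wA Ap _; apply: lowset_edge_le lp1.
- by apply: at_s3 wB Bq _; apply: lowset_edge_le lq2.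
Qed.

End Agents.
End MovingKnife.

(** * Serving the agents one after another *)

Section Allocation.
Variables (R : realType) (G : graph R).
Variables (up : gE G -> bool) (depth : gV G -> nat).
Hypothesis child_inj : injective (child up).
Hypothesis depth_lt : forall e, (depth (parent up e) < depth (child up e))%N.
Local Notation point := (cake_point G).

Variables (n : nat) (v : 'I_n -> set point -> R).
Hypothesis vP : forall i, valuation (v i).

(** [S] is the set of served agents and [prev i] that of the agents served before
    [i]; the last clause counts the pieces of [P i] that are still intact. *)
Lemma shares_above (a0 : gV G) (t : 'I_n -> R) (P : 'I_n -> 'I_n -> set point) :
  (forall i, kpartition (P i)) -> (forall i k, t i <= v i (P i k)) ->
  forall m, (m <= n)%N ->
  exists (S : {set 'I_n}) (cs : 'I_n -> knife G) (prev : 'I_n -> {set 'I_n}),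
  [/\ #|S| = m,
      forall i, i \in S -> (prev i \subset S) && (t i <= v i (share up cs i (prev i))),
      forall i j, i \in S -> j \in S -> i != j -> (i \in prev j) || (j \in prev i),
      forall i, 0 <= (cs i).2 <= \sum_(e : gE G) glen e &
      forall i, i \notin S -> (n - m <= #|[set k | `[<P i k `<=` rest up cs S>]]%SET|)%N].
Proof.
move=> part tP; elim=> [|m IH] mn.
  exists finset.set0, (fun=> (inl a0, 0)), (fun=> finset.set0).
  split=> //=.
  - by rewrite cards0.
  - by move=> i; rewrite inE.
  - by move=> i j; rewrite inE.
  - by move=> i; rewrite lexx; apply: sumr_ge0 => e _; exact: ltW (glen_pos e).
  - move=> i _; rewrite subn0.
    rewrite (_ : [set k | _]%SET = finset.setT) ?cardsT ?card_ord //.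
    by apply/setP => k; rewrite !inE; apply/asboolP => p _ j; rewrite inE.
have [S [cs [prev [cS Sok Sord csP Srest]]]] := IH (ltnW mn).
have worthyP i k : `[<P i k `<=` rest up cs S>] -> worthy up v t cs S (P i k) i.
  by move=> /asboolP sub; have [/(_ k)[pP cP] _] := part i; split.
have [i0 i0S] : exists i0, i0 \notin S.
  apply/existsP; rewrite -negb_forall; apply/negP => /forallP SA.
  have ST : S = finset.setT by apply/setP => x; rewrite inE SA.
  by move: mn; rewrite -cS ST cardsT card_ord ltnn.
have exw i : i \notin S -> exists X, worthy up v t cs S X i.
  move=> iS; have : (0 < #|[set k | `[<P i k `<=` rest up cs S>]]%SET|)%N.
    by apply: leq_trans (Srest i iS); rewrite subn_gt0.
  by case/card_gt0P => k; rewrite inE => /worthyP; exists (P i k).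
have [i [c [iS ti cP meet]]] := knife_step child_inj depth_lt vP a0 i0S exw.
have neqS j : j \in S -> j != i by move=> jS; apply: contraNneq iS => <-.
(* The new agent comes last, so exactly the agents in [S] precede it. *)
exists (i |: S)%SET, (update cs i c), (fun j => if j == i then S else prev j).
split.
- by rewrite cardsU1 iS cS.
- move=> j; rewrite !inE => /predU1P[->|jS].
    by rewrite eqxx share_update // ti finset.subsetUr.
  rewrite (negPf (neqS _ jS)); have /andP[pS tj] := Sok j jS.
  rewrite (fintype.subset_trans pS) ?finset.subsetUr //= share_update_neq ?neqS //.
  by apply: contra iS; apply: (fintype.subsetP pS).
- move=> j k; rewrite !inE => /predU1P[->|jS] /predU1P[->|kS] jk.
  + by rewrite eqxx in jk.
  + by rewrite eqxx kS orbT.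
  + by rewrite eqxx jS.
  + by rewrite (negPf (neqS _ kS)) (negPf (neqS _ jS)); apply: Sord.
- by move=> j; rewrite /update; case: eqP.
move=> j; rewrite !inE negb_or => /andP[ji jS].
set K' := [set k | _]%SET; set K := [set k | `[<P j k `<=` rest up cs S>]]%SET.
(* A piece that was intact before this round and is damaged by it meets the new part. *)
have hit k : k \in (K :\: K')%SET ->
    worthy up v t cs S (P j k) j /\ P j k `&` lowset up c !=set0.
  rewrite !inE => /andP[nk kK]; split; first exact: worthyP.
  apply: contrapT => H; move: nk => /asboolPn; apply => p Pp l.
  rewrite !inE /update => /predU1P[->|lS].
    by rewrite eqxx => cp; apply: H; exists p.
  by rewrite (negPf (neqS _ lS)); move/asboolP: kK => /(_ p Pp); apply.
(* Two damaged pieces would intersect by [meet], yet pieces of one partition are disjoint. *)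
have KK' : (#|K :\: K'| <= 1)%N.
  apply/card_le1_eqP => k l /hit[wk mk] /hit[wl ml].
  apply/eqP/negPn/negP => kl; have [_ /(_ _ _ kl) disj] := part j.
  by have := meet j _ _ jS wl wk ml mk; rewrite disj => -[].
rewrite subnS -subn1 leq_subLR addnC; apply: leq_trans (Srest j jS) _.
rewrite -/K -(cardsID K' K) leq_add // subset_leq_card //.
exact: finset.subsetIr.
Qed.

End Allocation.

(** * Passing to the limit *)

Section UltraLimit.
Variables (T : Type) (F : set_system T).
Hypothesis FU : UltraFilter F.

(** Pigeonhole: otherwise [F] contains the complements of all fibres, finitely many sets with empty
    intersection. *)
Lemma ultra_finite (A : finType) (f : T -> A) : exists a, F [set x | f x = a].
Proof.
have FP : ProperFilter F := @ultra_proper _ _ FU.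
apply: contrapT => H.
have : F [set x | forall a, f x <> a].
  apply: filter_forall => a.
  by have [h|//] := in_ultra_setVsetC [set x | f x = a] FU; case: H; exists a.
by case/filter_ex => x /(_ (f x)).
Qed.

(** Compactness of the segment gives a cluster point, and a cluster point of an ultrafilter is a
    limit. *)
Lemma ultra_bounded_cvg (R : realType) (u : T -> R) a b :
  (forall x, a <= u x <= b) ->
  exists l, forall eps, 0 < eps -> F [set x | `|u x - l| < eps].
Proof.
move=> ub; have FP : ProperFilter F := @ultra_proper _ _ FU.
have FA : (u @ F) [set` `[a, b]].
  by apply: nearW => x /=; rewrite in_itv /= ub.
have [l [_ cl]] := @segment_compact R a b (u @ F) _ FA.
exists l => eps eps0.
have [//|nV] := in_ultra_setVsetC [set x | `|u x - l| < eps] FU.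
have nb : nbhs l [set y | `|y - l| < eps].
  by apply/nbhs_ballP; exists eps => //= y; rewrite /ball /= distrC.
by have [y [/= ny ly]] := cl [set y | ~ `|y - l| < eps] _ nV nb.
Qed.

End UltraLimit.

(** * Finiteness of the maximin shares and existence of a maximin allocation *)

Section Main.
Variables (R : realType) (G : graph R).
Local Notation point := (cake_point G).

(** Empty pieces give the lower bound 0 and the whole cake an upper bound. For [n = 0] the minimum
    over no pieces would be [+oo]. *)
Lemma MMS_fin (v : set point -> R) n : (0 < n)%N -> valuation v -> MMS v n \is a fin_num.
Proof.
move=> n0 [v0 mono _ _].
pose full : set point := [set p | match p with PV _ => True | PE e x => 0 < x < glen e end].
have pfull : is_piece full.
  by apply: edgewise_itv_piece; exists (fun=> `]-oo, +oo[) => e x; rewrite in_itv /= andbT.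
have sub X : is_piece X -> X `<=` full.
  move=> [W [I [IP ->]]] p [[w _ <-] //|[[e i] ei [x xi ->]]].
  have /= /andP[x0 xl] := IP _ ei _ xi; rewrite /pos /full /=.
  case: eqP => // /eqP xn0; case: eqP => // /eqP xnl.
  by rewrite !lt_neqAle x0 xl xnl eq_sym xn0.
have piece0 : is_piece (set0 : set point).
  by apply: edgewise_itv_piece; exists (fun=> `]0, 0[) => e x; rewrite in_itv /=; split=> //; lra.
rewrite fin_numElt; apply/andP; split.
  apply: (@lt_le_trans _ _ 0%E); first exact: ltNyr.
  apply: (@le_trans _ _ (\big[Order.min/+oo%E]_(j < n) (v set0)%:E)%E).
    by apply/bigmin_geP; split=> [|j _]; rewrite ?leey // lee_fin v0.
  apply: ereal_sup_ubound; exists (fun=> set0) => //; split; last by move=> j k _; rewrite set0I.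
  by move=> j; split=> // p q [].
apply: (@le_lt_trans _ _ (v full)%:E); last exact: ltry.
apply: ge_ereal_sup => _ [P [Pc _] <-].
apply: (@le_trans _ _ (v (P (Ordinal n0)))%:E); first exact: bigmin_le_cond.
rewrite lee_fin; have [pP _] := Pc (Ordinal n0).
by apply: mono => //; exact: sub.
Qed.

Lemma MMS_adherent (v : set point -> R) n (t : R) : (t%:E < MMS v n)%E ->
  exists P : 'I_n -> set point, kpartition P /\ forall k, t <= v (P k).
Proof.
move=> /ereal_sup_gt[_ [P pP <-] lt]; exists P; split=> // k.
rewrite -lee_fin; apply: (le_trans (ltW lt)); exact: bigmin_le_cond.
Qed.

End Main.

Theorem theorem1 (R : realType) (G : graph R) :
  is_forest G ->
  forall (n : nat), (0 < n)%N ->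
  forall (v : 'I_n -> set (@cake_point R G) -> R),
    (forall i, valuation (v i)) ->
    exists A : 'I_n -> set (@cake_point R G),
      allocation A /\ forall i, (MMS (v i) n <= (v i (A i))%:E)%E.
Proof.
move=> Gf n n0 v vP.
pose mms i := fine (MMS (v i) n).
have mmsE i : MMS (v i) n = (mms i)%:E by rewrite fineK // MMS_fin.
suff [A [Aok Ale]] : exists A : 'I_n -> set (cake_point G),
    allocation A /\ forall i, mms i <= v i (A i).
  by exists A; split=> // i; rewrite mmsE lee_fin.
have part (m : nat) i : exists P : 'I_n -> set (cake_point G),
    kpartition P /\ forall k, mms i - m.+1%:R^-1 <= v i (P k).
  by apply: MMS_adherent; rewrite mmsE lte_fin ltrBlDr ltrDl invr_gt0 ltr0n.
(* Without vertices there are no edges either, hence no points: all sets coincide and any partition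
   serves as an allocation. *)
have [a0 _|noV] := pickP (fun _ : gV G => true); last first.
  have /choice[P PP] := part 0%N.
  exists (P (Ordinal n0)); split; first by case: (PP (Ordinal n0)).
  have PE (X Y : set (cake_point G)) : X = Y.
    by apply/seteqP; split=> -[a|e x]; by [have := noV a|have := noV (gsrc e)].
  move=> i; apply/ler_addgt0Pl => eps eps0.
  have [m /ltW me] := ltr_add_invr eps0.
  have [Q [_ Qm]] := part m i; have := Qm i; rewrite (PE (Q i) (P (Ordinal n0) i)).
  by move: me; rewrite add0r; move: (_^-1) => d; lra.
have [up [depth [child_inj depth_lt]]] := forest_rooting Gf.
have fex (m : nat) : exists c : ('I_n -> knife G) * ('I_n -> {set 'I_n}),
   [/\ forall i, mms i - m.+1%:R^-1 <= v i (share up c.1 i (c.2 i)),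
      forall i j, i != j -> (i \in c.2 j) || (j \in c.2 i) &
      forall i, 0 <= (c.1 i).2 <= \sum_(e : gE G) glen e].
  have /choice[P PP] := part m.
  have [S [cs [prev [cS Sok Sord csP _]]]] := shares_above child_inj depth_lt vP a0
    (fun i => (PP i).1) (fun i => (PP i).2) (leqnn n).
  have ST i : i \in S.
    suff -> : S = finset.setT by rewrite inE.
    by apply/eqP; rewrite eqEcard finset.subsetT cardsT card_ord cS /=.
  exists (cs, prev); split=> //= [i|i j ij]; first by case/andP: (Sok i (ST i)).
  exact: Sord.
have [f fP] := choice fex.
have [F [FU Foo]] := ultraFilterLemma eventually_filter.
have FP : ProperFilter F := @ultra_proper _ _ FU.
(* The discrete data of the allocation, as finite functions so that they range over a finite
   type. *)
pose kind m := ([ffun i => ((f m).1 i).1], [ffun i => (f m).2 i]).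
have [[kd pv] Fk] := ultra_finite FU kind.
have /choice[l lP] : forall i, exists l, forall eps, 0 < eps ->
    F [set m | `|((f m).1 i).2 - l| < eps].
  move=> i; apply: (ultra_bounded_cvg FU (a := 0) (b := \sum_(e : gE G) glen e)) => m.
  by case: (fP m).
pose cs i : knife G := (kd i, l i).
have kindP m : kind m = (kd, pv) ->
    (forall i, ((f m).1 i).1 = kd i) /\ (forall i, (f m).2 i = pv i).
  by move=> [<- <-]; split=> i; rewrite ffunE.
exists (fun i => share up cs i (pv i)); split.
  split=> [i|i j ij].
    by split; [apply: share_piece|apply: share_connected].
  (* Any index of the limiting kind shows that, of two agents, one precedes the other in [pv].
     Disjointness follows from this alone, whatever the knife positions. *)
  have [m /kindP[_ pvE]] := filter_ex Fk.
  have [_ /(_ i j ij) + _] := fP m; rewrite !pvE => /orP[iP|jP];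
    rewrite -subset0 => p [[ci ri] [cj rj]].
  - exact: (rj i).
  - exact: (ri j).
move=> i; apply/ler_addgt0Pl => eps eps0.
(* One half of [eps] pays for moving the knives to their limits, the other for the error
   [m.+1%:R^-1]. *)
have eps20 : 0 < eps / 2 by rewrite divr_gt0.
have [eta eta0 Heta] := share_continuous up cs i (pv i) (vP i) eps20.
have [N /ltW Ne] := ltr_add_invr eps20.
have Fl : F [set m | forall j, `|((f m).1 j).2 - l j| < eta].
  by apply: filter_forall => j; apply: lP.
have FN : F [set m | (N <= m)%N] by apply: Foo; exists N.
have [m [/kindP[kdE pvE] [/= lm Nm]]] := filter_ex (filterI Fk (filterI Fl FN)).
have [/(_ i) vm _ _] := fP m.
have := Heta (f m).1 kdE lm; rewrite -(pvE i) ltr_norml => /andP[_ h].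
have : m.+1%:R^-1 <= N.+1%:R^-1 :> R by rewrite lef_pV2 ?posrE ?ltr0n // ler_nat.
move: Ne vm h; rewrite add0r !pvE; move: (N.+1%:R^-1) (m.+1%:R^-1) => d d'.
lra.
Qed.
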